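(* Let $m\ge 1$ be an integer. For every integer $n\ge 0$, $$D_{-m}(n)=\det\bigl(C_{i+j-m}\bigr)_{i,j=0}^{n-1}=p_{m+1}(-n).$$ Equivalently: $D_{-m}(n)=0$ for $1\le n\le m$, and for $n\ge m+1$ $$D_{-m}(n)=(-1)^{\binom{m+1}{2}}\,p_{m+1}(n-m-1)=(-1)^{\binom{m+1}{2}}\,D_{m+1}(n-m-1).$$
   Context: $C_n=\frac{1}{n+1}\binom{2n}{n}$ for $n\ge 0$ are the Catalan numbers, extended to all $n\in\mathbb Z$ by $C_n=0$ for $n<0$. For $m\in\mathbb Z$ and $n\ge 0$, $D_m(n)=\det(C_{m+i+j})_{i,j=0}^{n-1}$ (the determinant of the $0\times 0$ matrix is $1$). For an integer $m\ge 0$, $p_m(n)$ denotes the polynomial in $n$ given by $p_m(n)=\prod_{1\le i\le j\le m-1}\frac{2n+i+j}{i+j}$ (empty product $=1$, so $p_0=p_1=1$); it is known that $D_m(n)=p_m(n)$ for all integers $m,n\ge 0$. *)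

(* Defs.v *)
From mathcomp Require Import all_boot all_order all_algebra.
Set Implicit Arguments. Unset Strict Implicit. Unset Printing Implicit Defensive.
Import Order.TTheory GRing.Theory Num.Theory.
Local Open Scope ring_scope.

Definition catalan (z : int) : rat :=
  match z with
  | Posz n => ('C(n.*2, n))%:R / (n.+1)%:R
  | Negz _ => 0
  end.

Definition hankelD (m : int) (n : nat) : rat :=
  \det (\matrix_(i < n, j < n) catalan (m + (i : nat)%:Z + (j : nat)%:Z)).

(* p_m(x) = prod_{1 <= i <= j <= m-1} (2x + i + j)/(i + j), as a function of a
   rational argument x (so it can be evaluated at negative integers). *)
Definition pPoly (m : nat) (x : rat) : rat :=
  \prod_(1 <= i < m) \prod_(i <= j < m) ((2 * x + i%:R + j%:R) / (i + j)%:R).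

(* Main.v *)
(** Both sides are determined by the same three-term relation. The
    Desnanot-Jacobi identity gives
      D_m(n+2) D_(m+2)(n) = D_m(n+1) D_(m+2)(n+1) - D_(m+1)(n+1)^2
    for every integer m, and the polynomials p_m satisfy, identically in x,
      p_m(x+1) p_(m+2)(x-1) = p_m(x) p_(m+2)(x) - p_(m+1)(x)^2.
    At x = n+1 this yields D_m(n) = p_m(n) for m >= 0, by induction on n. At
    x = -(n+1), with the roles of the outer indices exchanged, it is the
    relation between D_(-1-m), D_(-m) and D_(1-m), which yields
    D_(1-m)(n) = p_m(-n) by induction on m and n: the divisor p_m(-n) vanishes
    only for 0 < n < m, and for 0 < n+2 < m+2 both D_(-1-m)(n+2) and
    p_(m+2)(-(n+2)) are zero anyway. *)

Require Import Defs.
From mathcomp Require Import all_boot all_order all_algebra all_fingroup ring lra zify.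
Set Implicit Arguments. Unset Strict Implicit. Unset Printing Implicit Defensive.
Import Order.TTheory GRing.Theory Num.Theory.
Local Open Scope ring_scope.

(** * Determinants under reindexing and block triangular form *)

Lemma det_reindex (R : comNzRingType) n (f : 'I_n -> 'I_n) (A : 'M[R]_n) :
  injective f -> \det (\matrix_(i, j) A (f i) (f j)) = \det A.
Proof.
move=> f_inj; pose s := perm f_inj.
have -> : \matrix_(i, j) A (f i) (f j) = row_perm s (col_perm s A).
  by apply/matrixP=> i j; rewrite !mxE !permE.
(* Rows and columns carry the same permutation, so its sign occurs twice and cancels. *)
rewrite row_permE col_permE !det_mulmx !det_perm odd_permV mulrCA.
by rewrite -signr_addb addbb mulr1.
Qed.

Lemma det_upper (R : comNzRingType) m n (M : 'M[R]_(m + n)) :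
  dlsubmx M = 0 -> \det M = \det (ulsubmx M) * \det (drsubmx M).
Proof. by move=> M0; rewrite -{1}[M]submxK M0 det_ublock. Qed.

Lemma det_lower (R : comNzRingType) m n (M : 'M[R]_(m + n)) :
  ursubmx M = 0 -> \det M = \det (ulsubmx M) * \det (drsubmx M).
Proof. by move=> M0; rewrite -{1}[M]submxK M0 det_lblock. Qed.

Lemma det_mx2 (R : comNzRingType) (M : 'M[R]_2) :
  \det M = M 0 0 * M 1 1 - M 0 1 * M 1 0.
Proof.
rewrite (expand_det_row _ 0) !big_ord_recl big_ord0 /cofactor !det_mx11 !mxE /=.
rewrite expr0 expr1 mul1r mulN1r mulrN addr0.
by congr (M _ _ * M _ _ - M _ _ * M _ _); apply: val_inj.
Qed.

(** * The Desnanot-Jacobi identity *)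

Section Desnanot.
Variables (R : idomainType) (n : nat).
Implicit Type A : 'M[R]_n.+2.

(* Reordering that puts the first and last index in front, so that the matrices
   below become block triangular with the interior minor as a diagonal block. *)
Let ends_first (i : 'I_n.+2) : 'I_n.+2 :=
  match split (i : 'I_(2 + n)) with
  | inl k => if k == 0 then ord0 else ord_max
  | inr k => lift ord0 (lift ord_max k)
  end.

Let ends_first_inj : injective ends_first.
Proof.
move=> i j; rewrite /ends_first.
case: (splitP (i : 'I_(2 + n))) => k ik; case: (splitP (j : 'I_(2 + n))) => l jl.
- move=> e; apply: val_inj; rewrite /= ik jl.
  by case: k l e {ik jl} => [[|[|?]] ?] [[|[|?]] ?] //= /(congr1 val).
- move/(congr1 val); case: ifP => _; rewrite /= ?lift0 ?lift_max //= => e.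
  by have := ltn_ord l; move: e; rewrite /bump /=; lia.
- move/(congr1 val); case: ifP => _; rewrite /= ?lift0 ?lift_max //= => e.
  by have := ltn_ord k; move: e; rewrite /bump /=; lia.
- move=> /lift_inj/lift_inj e; apply: val_inj; rewrite /= ik jl e //.
Qed.

Let ends_firstl (k : 'I_2) :
  ends_first (lshift n k) = if k == 0 then ord0 else ord_max.
Proof. by rewrite /ends_first -[lshift n k]/(unsplit (inl k)) unsplitK. Qed.

Let ends_firstr (k : 'I_n) :
  ends_first (rshift 2 k) = lift ord0 (lift ord_max k).
Proof. by rewrite /ends_first -[rshift 2 k]/(unsplit (inr k)) unsplitK. Qed.

Lemma Desnanot_Jacobi_regular A : \det A != 0 ->
  \det A * \det (row' ord_max (col' ord_max (row' ord0 (col' ord0 A)))) =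
  \det (row' ord0 (col' ord0 A)) * \det (row' ord_max (col' ord_max A)) -
  \det (row' ord0 (col' ord_max A)) * \det (row' ord_max (col' ord0 A)).
Proof.
move=> dA0.
have mid_end k : (lift ord0 (lift ord_max k) == ord0 :> 'I_n.+2)
    || (lift ord0 (lift ord_max k) == ord_max :> 'I_n.+2) = false.
  by rewrite -!val_eqE /= /bump /=; have := ltn_ord k; lia.
have end_mid (k : 'I_2) l :
    ((if k == 0 then ord0 else ord_max) == lift ord0 (lift ord_max l) :> 'I_n.+2)
    = false.
  by rewrite -val_eqE /= /bump /=; have := ltn_ord l; case: ifP => _ /=; lia.
have end_end (k : 'I_2) : ((if k == 0 then ord0 else ord_max) == ord0 :> 'I_n.+2)
    || ((if k == 0 then ord0 else ord_max) == ord_max :> 'I_n.+2).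
  by case: ifP; rewrite eqxx ?orbT.
(* Jacobi's trick: [A *m N] is A with its end columns replaced by multiples of
   unit vectors, so its determinant is [\det A ^+ 2] times the interior minor. *)
pose N : 'M[R]_n.+2 := \matrix_(i, j)
  if (j == ord0) || (j == ord_max) then (\adj A) i j else (i == j)%:R.
have AN i j : (A *m N) i j =
    if (j == ord0) || (j == ord_max) then \det A *+ (i == j) else A i j.
  case: ifP => je.
    have <- : (A *m \adj A) i j = \det A *+ (i == j).
      by rewrite mul_mx_adj mxE.
    by rewrite !mxE; apply: eq_bigr => k _; rewrite !mxE je.
  rewrite mxE (bigD1 j) //= big1 => [|k kj]; first by rewrite mxE je eqxx mulr1 addr0.
  by rewrite mxE je (negPf kj) mulr0.
have detN : \det N = (\adj A) ord0 ord0 * (\adj A) ord_max ord_max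
                     - (\adj A) ord0 ord_max * (\adj A) ord_max ord0.
  (* The interior columns of [N] are unit vectors, so only the 2 x 2 corner block of the adjugate
     counts. *)
  rewrite -(det_reindex N ends_first_inj) (@det_lower _ 2 n); last first.
    apply/matrixP=> i j; rewrite !mxE /= ends_firstl ends_firstr.
    by rewrite mid_end end_mid.
  set X := drsubmx _; have -> : X = 1%:M.
    apply/matrixP=> i j; rewrite !mxE /= !ends_firstr mid_end.
    by rewrite (inj_eq lift_inj) (inj_eq lift_inj).
  by rewrite det1 mulr1 det_mx2 !mxE !ends_firstl /= eqxx mulrC [X in _ - X]mulrC.
have detAN : \det (A *m N) = \det A ^+ 2 *
    \det (row' ord_max (col' ord_max (row' ord0 (col' ord0 A)))).
  rewrite -(det_reindex (A *m N) ends_first_inj) (@det_upper _ 2 n); last first.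
    apply/matrixP=> i j.
    rewrite dlsubmxEsub [LHS]mxE [LHS]mxE AN ends_firstl ends_firstr.
    by rewrite end_end eq_sym end_mid mxE.
  set X := ulsubmx _; have -> : X = (\det A)%:M.
    apply/matrixP=> i j; rewrite /X ulsubmxEsub [LHS]mxE [LHS]mxE AN !ends_firstl.
    rewrite end_end mxE.
    congr (_ *+ _); case: i => [[|[|?]] ?] //; case: j => [[|[|?]] ?] //.
    by rewrite eqxx.
  rewrite det_scalar; congr (_ * \det _); apply/matrixP=> i j.
  by rewrite drsubmxEsub [LHS]mxE [LHS]mxE AN !ends_firstr mid_end !mxE.
apply: (mulfI dA0); rewrite mulrA -expr2 -detAN det_mulmx detN.
have sign2 : (-1) ^+ n.+1 * (-1) ^+ n.+1 = 1 :> R by rewrite -expr2 sqrr_sign.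
rewrite !mxE /cofactor /= !addn0 add0n exprD sign2 expr0 !mul1r.
by rewrite mulrACA sign2 mul1r [X in _ - X]mulrC.
Qed.
End Desnanot.

Lemma Desnanot_Jacobi (R : idomainType) n (A : 'M[R]_n.+2) :
  \det A * \det (row' ord_max (col' ord_max (row' ord0 (col' ord0 A)))) =
  \det (row' ord0 (col' ord0 A)) * \det (row' ord_max (col' ord_max A)) -
  \det (row' ord0 (col' ord_max A)) * \det (row' ord_max (col' ord0 A)).
Proof.
(* The general case is the regular one for ['X - (- A)], evaluated at 0. *)
pose B := char_poly_mx (- A).
have AE : A = map_mx (horner_eval 0) B.
  apply/matrixP=> i j; rewrite !mxE /horner_eval /= !hornerE.
  by case: (i == j); rewrite !hornerE ?opprK.
have /Desnanot_Jacobi_regular : \det B != 0 by exact: monic_neq0 (char_poly_monic _).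
rewrite AE -!map_col' -!map_row' -!map_col' -!map_row' !det_map_mx.
rewrite -!rmorphM -rmorphB => E.
exact: (congr1 _ E).
Qed.

(** * Recurrence and vanishing of Hankel determinants *)

Lemma hankel_recurrence (m : int) n :
  hankelD m n.+2 * hankelD (m + 2) n =
  hankelD m n.+1 * hankelD (m + 2) n.+1 - hankelD (m + 1) n.+1 ^+ 2.
Proof.
pose A : 'M_n.+2 :=
  \matrix_(i < n.+2, j < n.+2) catalan (m + (i : nat)%:Z + (j : nat)%:Z).
have -> : hankelD (m + 2) n =
    \det (row' ord_max (col' ord_max (row' ord0 (col' ord0 A)))).
  congr (\det _); apply/matrixP=> i j; rewrite !mxE; congr catalan.
  by rewrite /= /bump /=; have := ltn_ord i; have := ltn_ord j; lia.
(* Each deletion of a first row or first column raises the shift by 1, so the two mixed minors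
   coincide and give the square. *)
rewrite (Desnanot_Jacobi A) mulrC expr2; congr (_ * _ - _ * _);
  congr (\det _); apply/matrixP=> i j; rewrite !mxE; congr catalan;
  have /= := ltn_ord i; have /= := ltn_ord j; rewrite /bump /=; lia.
Qed.

(** The first row involves only Catalan numbers of negative index. *)
Lemma hankelD_eq0 m n : (0 < n < m)%N -> hankelD (1 - m%:Z) n = 0.
Proof.
case: n => // n /= nm; rewrite /hankelD (expand_det_row _ ord0) big1 // => j _.
rewrite mxE; set z := (z in catalan z).
have : z < 0 by rewrite /z /=; have := ltn_ord j; lia.
by case: z => //= k _; rewrite mul0r.
Qed.

(** * The product formula and its three-term relation *)

Definition pRatio (m : nat) (x : rat) : rat :=
  \prod_(1 <= i < m.+1) ((2 * x + i%:R + m%:R) / (i + m)%:R).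

Lemma pPolyS m x : pPoly m.+1 x = pPoly m x * pRatio m x.
Proof.
rewrite /pPoly /pRatio; case: m => [|m]; first by rewrite !big_geq ?mulr1.
transitivity (\prod_(1 <= i < m.+2) ((\prod_(i <= j < m.+1)
    ((2 * x + i%:R + j%:R) / (i + j)%:R)) *
    ((2 * x + i%:R + m.+1%:R) / (i + m.+1)%:R) : rat)).
  by apply: eq_big_nat => i /andP[_ im]; rewrite big_nat_recr.
rewrite big_split /=; congr (_ * _).
by rewrite big_nat_recr //= [X in _ * X]big_geq ?mulr1.
Qed.

(** Passing from x to x + 1 turns the numerator of index i into that of index i + 2, so all but two
    factors at each end cancel. *)
Lemma pRatio_addr1 m x :
  pRatio m (x + 1) * ((2 * x + m%:R + 1) * (2 * x + m%:R + 2)) =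
  pRatio m x * ((2 * x + 2 * m%:R + 1) * (2 * x + 2 * m%:R + 2)).
Proof.
rewrite /pRatio.
(* The upper bound [N] is separated from the [m] inside the factors, so that induction can run on it
   alone. *)
suff H N : (\prod_(1 <= i < N.+1) ((2 * (x + 1) + i%:R + m%:R) / (i + m)%:R)) *
    ((2 * x + m%:R + 1) * (2 * x + m%:R + 2)) =
  (\prod_(1 <= i < N.+1) ((2 * x + i%:R + m%:R) / (i + m)%:R)) *
    ((2 * x + N%:R + m%:R + 1) * (2 * x + N%:R + m%:R + 2)) :> rat.
  by rewrite H; ring.
elim: N => [|N IH]; first by rewrite !big_geq //; ring.
rewrite !(big_nat_recr N.+1) //= mulrAC IH -[N.+1%:R]natr1 natrD -natr1; field.
by apply: lt0r_neq0; have := ler0n rat N; have := ler0n rat m; lra.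
Qed.

(** In terms of k = i + m the factor (2x + k)/k depends on k only. The range of k is m+1..2m for
    [pRatio m] and m+2..2m+2 for [pRatio m.+1]. *)
Lemma pRatioS m x :
  pRatio m.+1 x * (2 * (2 * m%:R + 1) * (2 * x + m%:R + 1)) =
  pRatio m x * ((2 * x + 2 * m%:R + 1) * (2 * x + 2 * m%:R + 2)).
Proof.
rewrite /pRatio.
pose g k : rat := (2 * x + k%:R) / k%:R.
have E k N : \prod_(1 <= i < N) ((2 * x + i%:R + k%:R) / (i + k)%:R) =
   \prod_(1 + k <= i < N + k) g i :> rat.
  by rewrite big_addn addnK; apply: eq_bigr => i _; rewrite /g natrD addrA.
rewrite !E !add1n.
have -> : (m.+2 + m.+1 = m.*2.+3)%N by lia.
have -> : (m.+1 + m = m.*2.+1)%N by lia.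
have H : \prod_(m.+1 <= i < m.*2.+3) g i = g m.+1 * \prod_(m.+2 <= i < m.*2.+3) g i.
  by rewrite big_ltn //; lia.
have H' : \prod_(m.+1 <= i < m.*2.+3) g i =
   \prod_(m.+1 <= i < m.*2.+1) g i * g m.*2.+1 * g m.*2.+2.
  by rewrite (big_nat_recr m.*2.+2) ?(big_nat_recr m.*2.+1) //=; lia.
have -> : 2 * (2 * m%:R + 1) * (2 * x + m%:R + 1) =
    g m.+1 * (m.*2.+1%:R * m.*2.+2%:R).
  rewrite /g -muln2 -!natr1 natrM; field.
  by apply: lt0r_neq0; have := ler0n rat m; lra.
rewrite mulrA (mulrC _ (g m.+1)) -H H' /g.
rewrite -muln2 -[(m * 2).+2%:R]natr1 -[(m * 2).+1%:R]natr1 natrM.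
field.
by have m0 := ler0n rat m; rewrite !lt0r_neq0 //; lra.
Qed.

Lemma pRatio_gt0 m x : 0 <= x -> 0 < pRatio m x.
Proof.
move=> x0; rewrite /pRatio big_nat_cond; apply: prodr_gt0 => i /andP[/andP[i1 _] _].
have i0 : 0 < i%:R :> rat by rewrite ltr0n.
by rewrite divr_gt0 // ?natrD; have := ler0n rat m; lra.
Qed.

Lemma pPoly_0 x : pPoly 0 x = 1.
Proof. by rewrite /pPoly big_geq. Qed.

Lemma pPoly_1 x : pPoly 1 x = 1.
Proof. by rewrite /pPoly big_geq. Qed.

Lemma pPoly_gt0 m x : 0 <= x -> 0 < pPoly m x.
Proof.
move=> x0; elim: m => [|m IH]; first by rewrite pPoly_0.
by rewrite pPolyS mulr_gt0 ?pRatio_gt0.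
Qed.

Lemma pPoly_at0 m : pPoly m 0 = 1.
Proof.
rewrite /pPoly big_nat_cond big1 // => i /andP[/andP[i1 _] _].
rewrite big1 // => j _; rewrite mulr0 add0r -natrD divff // pnatr_eq0; lia.
Qed.

(** Induction on m: [pRatio_addr1] at x and at x - 1 gives the factor gained at each step. *)
Lemma pPoly_quotient m x : 1 <= x ->
  pPoly m (x + 1) * pPoly m (x - 1) *
    ((2 * x + m%:R - 1) * (2 * x + m%:R) ^+ 2 * (2 * x + m%:R + 1)) =
  pPoly m x ^+ 2 * (2 * x * (2 * x + 1) *
    (2 * x + 2 * m%:R - 1) * (2 * x + 2 * m%:R)).
Proof.
move=> x1; elim: m => [|m IH]; first by rewrite !pPoly_0; ring.
have := ler0n rat m.
have := pRatio_addr1 m x; have := pRatio_addr1 m (x - 1).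
rewrite subrK !pPolyS -[m.+1%:R]natr1.
move: (pPoly m (x + 1)) (pPoly m (x - 1)) (pPoly m x) IH => p q r.
move: (pRatio m (x + 1)) (pRatio m (x - 1)) (pRatio m x) (m%:R) => u v w k.
move=> IH Ew Eu k0.
have c0 : (2 * x + k - 1) * (2 * x + k) != 0.
  by rewrite mulf_neq0 // lt0r_neq0 //; lra.
apply: (mulIf c0).
transitivity (u * ((2 * x + k + 1) * (2 * x + k + 2)) * (p * q * v *
  ((2 * x + k - 1) * (2 * x + k) ^+ 2 * (2 * x + k + 1)))); first by ring.
rewrite Eu.
transitivity (p * q * ((2 * x + k - 1) * (2 * x + k) ^+ 2 * (2 * x + k + 1)) *
  (v * w * ((2 * x + 2 * k + 1) * (2 * x + 2 * k + 2)))); first by ring.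
rewrite IH.
transitivity (v * ((2 * (x - 1) + 2 * k + 1) * (2 * (x - 1) + 2 * k + 2)) *
  (r ^+ 2 * w * (2 * x * (2 * x + 1)) *
   ((2 * x + 2 * k + 1) * (2 * x + 2 * k + 2)))); first by ring.
by rewrite -Ew; ring.
Qed.

(* The bound on x only keeps the factors to be cancelled nonzero; it is removed
   below by comparing polynomials. *)
Lemma pPoly_condense_ge1 m x : 1 <= x ->
  pPoly m (x + 1) * pPoly m.+2 (x - 1) =
  pPoly m x * pPoly m.+2 x - pPoly m.+1 x ^+ 2.
Proof.
move=> x1; have := ler0n rat m; have := pPoly_quotient m x1.
have := pRatio_addr1 m (x - 1); have := pRatioS m x; have := pRatioS m (x - 1).
rewrite subrK !pPolyS.
move: (pPoly m (x + 1)) (pPoly m (x - 1)) (pPoly m x) => p q r.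
move: (pRatio m (x - 1)) (pRatio m x) (pRatio m.+1 (x - 1)) (pRatio m.+1 x).
move: (m%:R) => k v w v1 w1 Sv Sw Ew Q k0.
(* [c] is the multiplier of [pRatioS] at x and [d] that of [pRatio_addr1] at x - 1. They reduce both
   sides to [r ^+ 2 * w ^+ 2] times polynomials in x and k. *)
pose c := 2 * (2 * k + 1) * (2 * x + k + 1).
pose d := (2 * x + k - 1) * (2 * x + k).
have c0 : c * d ^+ 2 != 0.
  by rewrite mulf_neq0 ?expf_neq0 // !mulf_neq0 // lt0r_neq0 //; lra.
apply: (mulIf c0); rewrite /c /d.
transitivity (p * q * ((2 * x + k - 1) * (2 * x + k) ^+ 2 * (2 * x + k + 1)) *
  (v * (v1 * (2 * (2 * k + 1) * (2 * (x - 1) + k + 1))))); first by ring.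
rewrite Q Sv.
transitivity (r ^+ 2 * (2 * x * (2 * x + 1)) *
  (v * ((2 * (x - 1) + 2 * k + 1) * (2 * (x - 1) + 2 * k + 2))) ^+ 2);
  first by ring.
rewrite -Ew.
transitivity (r ^+ 2 * w * (w1 * (2 * (2 * k + 1) * (2 * x + k + 1)) -
   w * (2 * (2 * k + 1) * (2 * x + k + 1))) *
   ((2 * x + k - 1) * (2 * x + k)) ^+ 2); last by ring.
by rewrite Sw; ring.
Qed.

Lemma pPoly_horner m : exists P : {poly rat}, forall x, P.[x] = pPoly m x.
Proof.
exists (\prod_(1 <= i < m) \prod_(i <= j < m)
  ((2 *: 'X + i%:R%:P + j%:R%:P) * ((i + j)%:R^-1)%:P)) => x.
rewrite horner_prod; apply: eq_bigr => i _; rewrite horner_prod.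
by apply: eq_bigr => j _; rewrite !hornerE.
Qed.

Lemma pPoly_condense m x :
  pPoly m (x + 1) * pPoly m.+2 (x - 1) = pPoly m x * pPoly m.+2 x - pPoly m.+1 x ^+ 2.
Proof.
have [[P HP] [Q HQ] [S HS]] :=
  And3 (pPoly_horner m) (pPoly_horner m.+1) (pPoly_horner m.+2).
pose T : {poly rat} := (P \Po ('X + 1)) * (S \Po ('X - 1)) - (P * S - Q ^+ 2).
have TE y : T.[y] = pPoly m (y + 1) * pPoly m.+2 (y - 1)
     - (pPoly m y * pPoly m.+2 y - pPoly m.+1 y ^+ 2).
  rewrite /T !hornerE !horner_comp !hornerE.
  by rewrite !HP !HQ !HS.
suff T0 : T = 0 by apply/eqP; rewrite -subr_eq0 -TE T0 horner0.
(* A nonzero [T] has fewer than [size T] roots, yet 1, ..., [size T] are all roots. *)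
apply/eqP/negPn/negP => /max_poly_roots Tn0.
have : (size [seq i.+1%:R : rat | i <- iota 0 (size T)] < size T)%N.
  apply: Tn0.
    apply/allP=> _ /mapP[i _ ->]; rewrite /root TE pPoly_condense_ge1 ?subrr //.
    by rewrite ler1n.
  by rewrite map_inj_uniq ?iota_uniq // => i j /eqP; rewrite eqr_nat => /eqP[].
by rewrite size_map size_iota ltnn.
Qed.

(** The factor with i = j = n vanishes at -n. *)
Lemma pPoly_oppn_eq0 m n : (0 < n < m)%N -> pPoly m (- n%:R) = 0.
Proof.
case/andP=> n0; elim: m => // m IH; rewrite ltnS leq_eqVlt pPolyS => /orP[/eqP<-|/IH->].
  case: n n0 {IH} => // n _.
  by rewrite /pRatio big_nat_recr //= (_ : _ + _ + _ = 0) ?mul0r ?mulr0 //; ring.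
by rewrite mul0r.
Qed.

(** Here i + j <= 2(m - 1) < 2n, so every numerator is negative. *)
Lemma pPoly_oppn_neq0 m n : (m <= n)%N -> pPoly m (- n%:R) != 0.
Proof.
elim: m => [|m IH] mn; first by rewrite pPoly_0 oner_eq0.
rewrite pPolyS mulf_neq0 ?IH ?(ltnW mn) // /pRatio big_nat_cond.
apply: (big_ind (fun y => y != 0)) => [|y z|i /andP[/andP[i1 im] _]].
- exact: oner_neq0.
- exact: mulf_neq0.
have im' : i%:R <= m%:R :> rat by rewrite ler_nat.
have mn' : m%:R + 1 <= n%:R :> rat by rewrite natr1 ler_nat.
rewrite mulf_neq0 //; first by rewrite ltr0_neq0 //; lra.
by rewrite invr_eq0 pnatr_eq0; lia.
Qed.

(** * Catalan numbers as the values of p_m at 1 *)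

Lemma catalanS n : catalan n.+1 * (n%:R + 2) = catalan n * (2 * (2 * n%:R + 1)).
Proof.
have En : ('C(n.+1.*2, n.+1) * n.+1 = 'C(n.*2, n) * (2 * n.*2.+1))%N.
  (* Both binomials are compared with ['C(n.*2.+1, n)]. *)
  have E1 := mul_bin_diag n.*2.+2 n; have E2 := mul_bin_down n.*2.+1 n.
  rewrite /= (_ : n.*2.+1 - n = n.+1)%N in E1 E2; last by lia.
  by rewrite doubleS; nia.
rewrite /catalan; move/(congr1 (fun k : nat => k%:R : rat)): En.
have n0 := ler0n rat n.
have -> : n.+2%:R = n%:R + 2 :> rat by rewrite -addn2 natrD.
rewrite !natrM -[n.*2.+1%:R]natr1 -[n.+1%:R]natr1 -[n.*2]mul2n natrM => En.
apply: (mulIf (_ : n%:R + 1 != 0 :> rat)); first by rewrite lt0r_neq0 //; lra.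
transitivity (('C(n.+1.*2, n.+1))%:R * (n%:R + 1) : rat).
  by field; rewrite lt0r_neq0 //; lra.
by rewrite En; field; rewrite lt0r_neq0 //; lra.
Qed.

(** This settles the 1 x 1 determinants. Since [pRatio m 0] is 1, [pRatio_addr1] at 0 reproduces the
    Catalan recurrence. *)
Lemma pPoly_at1 m : pPoly m 1 = catalan m.
Proof.
elim: m => [|m IH]; first by rewrite pPoly_0 /= bin0 divr1.
have m0 := ler0n rat m.
have Rm : pRatio m 0 = 1.
  rewrite /pRatio big_nat_cond big1 // => i /andP[/andP[i1 _] _].
  by rewrite mulr0 add0r -natrD divff // pnatr_eq0; lia.
have m2 : (m%:R + 1) * (m%:R + 2) != 0 :> rat by rewrite mulf_neq0 // lt0r_neq0 //; lra.
apply: (mulIf m2); rewrite pPolyS IH.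
have := pRatio_addr1 m 0; rewrite Rm add0r mulr0 !add0r mul1r => Em.
rewrite -mulrA Em [RHS]mulrCA [in RHS]mulrC catalanS; ring.
Qed.

(** * Comparison of determinants and polynomials *)

Lemma hankelD0 m : hankelD m 0 = 1.
Proof. exact: det_mx00. Qed.

Lemma hankelD_pPoly (m n : nat) : hankelD m n = pPoly m n%:R.
Proof.
(* The recurrence links three consecutive sizes, so two are carried along, each for all shifts. *)
suff [] : (forall m : nat, hankelD m n = pPoly m n%:R) /\
          (forall m : nat, hankelD m n.+1 = pPoly m n.+1%:R) by [].
elim: n {m} => [|n [IH0 IH1]]; split=> m //.
- by rewrite hankelD0 pPoly_at0.
- by rewrite /hankelD det_mx11 mxE pPoly_at1; congr catalan; rewrite /= !addr0.
have := hankel_recurrence m n; have := pPoly_condense m n.+1%:R.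
rewrite -!PoszD !addn1 addn2 IH0 !IH1.
have -> : n.+1%:R + 1 = n.+2%:R :> rat by rewrite natr1.
have -> : n.+1%:R - 1 = n%:R :> rat by rewrite -natr1 addrK.
by move=> <- /mulIf; apply; rewrite lt0r_neq0 ?pPoly_gt0.
Qed.

Lemma hankelD_pPoly_opp (m n : nat) : hankelD (1 - m%:Z) n = pPoly m (- n%:R).
Proof.
suff [] : (forall n, hankelD (1 - m%:Z) n = pPoly m (- n%:R)) /\
          (forall n, hankelD (1 - m.+1%:Z) n = pPoly m.+1 (- n%:R)) by [].
elim: m {n} => [|m [IH0 IH1]]; split=> //.
(* The base shifts 1 and 0 are nonnegative, and p_0 = p_1 = 1 makes the exchange of indices
   harmless. *)
- by move=> n; rewrite subr0 hankelD_pPoly pPoly_0 pPoly_1.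
- by move=> n; rewrite subrr hankelD_pPoly pPoly_0 pPoly_1.
elim=> [|n IHn]; first by rewrite hankelD0 oppr0 pPoly_at0.
have [nm|mn] := ltnP n.+1 m.+2; first by rewrite hankelD_eq0 ?pPoly_oppn_eq0.
(* Outside the vanishing range the size is n + 2 with m <= n, so the divisor p_m(-n) is nonzero. *)
case: n mn IHn => // n mn IHn.
have := hankel_recurrence (1 - m.+2%:Z) n; have := pPoly_condense m (- n.+1%:R).
have -> : 1 - m.+2%:Z + 2 = 1 - m%:Z by lia.
have -> : 1 - m.+2%:Z + 1 = 1 - m.+1%:Z by lia.
rewrite IHn !IH0 IH1.
have -> : - n.+1%:R + 1 = - n%:R :> rat by rewrite -natr1; ring.
have -> : - n.+1%:R - 1 = - n.+2%:R :> rat by rewrite -[n.+2%:R]natr1; ring.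
rewrite [pPoly m _ * pPoly m.+2 (- n.+1%:R)]mulrC.
move=> <-; rewrite [pPoly m _ * _]mulrC => /mulIf; apply.
by rewrite pPoly_oppn_neq0.
Qed.

Theorem theorem1 (m : nat) (hm : (1 <= m)%N) (n : nat) :
  hankelD (- (m%:Z)) n = pPoly m.+1 (- (n%:R)).
Proof.
by rewrite -hankelD_pPoly_opp; congr hankelD; lia.
Qed.
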